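(* $$\lim_{X\to+\infty}\frac{\#\{0\le n\le X:\ \mathcal{J}_{10}(4n+1)\equiv 0\pmod 2\}}{X}=1.$$
   Context: Let $q=e^{2\pi i\tau}$, $(a;q)_\infty=\prod_{j\ge0}(1-aq^j)$, and $\eta(\tau)=q^{1/24}(q;q)_\infty$. Define $$j_{10}(\tau)=\frac{\eta(2\tau)\eta(5\tau)^5}{\eta(\tau)\eta(10\tau)^5}-1=\frac1q+\sum_{n\ge0}\mathcal{J}_{10}(n)q^n.$$ *)

(* Defs.v *)
From HB Require Import structures.
From mathcomp Require Import all_boot all_order all_algebra.
From mathcomp Require Import all_classical all_reals all_analysis.
Set Implicit Arguments. Unset Strict Implicit. Unset Printing Implicit Defensive.
Import Order.TTheory GRing.Theory Num.Theory.
Local Open Scope ring_scope.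

(* The eta quotient  eta(2t) eta(5t)^5 / (eta(t) eta(10t)^5)  equals
   q^{-1} * P(q) with the formal power series (integer coefficients)
     P(q) = (q^2;q^2)_oo (q^5;q^5)_oo^5 / ((q;q)_oo (q^10;q^10)_oo^5).
   [eta_trunc N] is a polynomial agreeing with P(q) in all degrees <= N:
   it is the product over 1 <= j <= N of the factors (1 - q^{2j})(1 - q^{5j})^5,
   and of the geometric series 1/(1-q^j) = sum_m q^{jm},
   1/(1-q^{10j})^5 = (sum_m q^{10jm})^5, truncated at m <= N.
   (Factors with j > N are 1 + O(q^{N+1}), and the truncations only drop
   terms of degree > N.) *)
Definition eta_trunc (N : nat) : {poly int} :=
  \prod_(1 <= j < N.+1)
     ((1 - 'X^(2 * j)) * (1 - 'X^(5 * j)) ^+ 5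
      * (\sum_(0 <= m < N.+1) 'X^(j * m))
      * (\sum_(0 <= m < N.+1) 'X^(10 * j * m)) ^+ 5).

Definition Pcoef (k : nat) : int := (eta_trunc k)`_k.

(* j10 = q^{-1} P(q) - 1 = 1/q + sum_{n >= 0} J10(n) q^n,
   so J10(n) = [q^{n+1}] P(q) - [n = 0]. *)
Definition J10 (n : nat) : int := Pcoef n.+1 - (n == 0)%:R.

Definition count_even {R : realType} (X : R) : nat :=
  count (fun n => (2 %| J10 (4 * n + 1))%Z) (iota 0 (Num.truncn X).+1).

(* Main.v *)
(* Modulo 2, write f_k for the product of the 1 - q^(k j) and A = f_1, B = f_5.
   Since f_2 = A^2 and f_10 = B^2, the eta quotient is q^-1 T with T = A / B^5.
   Jacobi's triple product gives A^3 = psi(q), the sum of q^(j (j + 1) / 2), and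
   A B = f(q, q^4) f(q^2, q^3). Counting representations by sums of two squares,
   with multiplication by 2 - i in Z[i] and the obvious reflections, shows
   A B = psi(q)^2 + q psi(q^5)^2 = A^6 + q B^6. Hence T = (A / B)^6 + q, and
   A / B = A^6 / B^2 + q B^4, so that two successive 2-dissections identify the
   coefficient of q^(4 n + 2) in T with that of q^n in
   A^6 + q B^6 = psi(q^2) + q psi(q^10). It is odd only if n = r (r + 1) or
   n = 5 r (r + 1) + 1, a set of density zero. *)
Require Import Defs.
From HB Require Import structures.
From mathcomp Require Import all_boot all_order all_algebra.
From mathcomp Require Import all_classical all_reals all_analysis.
From mathcomp Require Import ring lra zify.
Import Order.TTheory GRing.Theory Num.Theory numFieldNormedType.Exports.
Local Open Scope classical_set_scope.
Local Open Scope ring_scope.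
Set Implicit Arguments.
Unset Strict Implicit.

(** * Congruences of polynomials modulo a power of X *)

Definition eqX (R : nzRingType) (M : nat) (p q : {poly R}) :=
  forall i, (i < M)%N -> p`_i = q`_i.

Lemma eqX_refl (R : nzRingType) M (p : {poly R}) : eqX M p p.
Proof. by []. Qed.

Lemma eqX_sym (R : nzRingType) M (p q : {poly R}) : eqX M p q -> eqX M q p.
Proof. by move=> h i /h. Qed.

Lemma eqX_trans (R : nzRingType) M (p q r : {poly R}) :
  eqX M p q -> eqX M q r -> eqX M p r.
Proof. by move=> h1 h2 i lti; rewrite h1 ?h2. Qed.

Lemma eqXW (R : nzRingType) M N (p q : {poly R}) :
  (M <= N)%N -> eqX N p q -> eqX M p q.
Proof. by move=> le h i lti; apply: h; apply: leq_trans le. Qed.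

Lemma eqXD (R : nzRingType) M (p p' q q' : {poly R}) :
  eqX M p p' -> eqX M q q' -> eqX M (p + q) (p' + q').
Proof. by move=> h1 h2 i lti; rewrite !coefD h1 ?h2. Qed.

Lemma eqXM (R : nzRingType) M (p p' q q' : {poly R}) :
  eqX M p p' -> eqX M q q' -> eqX M (p * q) (p' * q').
Proof.
move=> h1 h2 i lti; rewrite !coefM; apply: eq_bigr => j _.
by have ltj := ltn_ord j; rewrite h1 ?h2 //; lia.
Qed.

Lemma eqX_exp (R : nzRingType) M (p q : {poly R}) k :
  eqX M p q -> eqX M (p ^+ k) (q ^+ k).
Proof.
by move=> h; elim: k => // k IH; rewrite !exprS; apply: eqXM.
Qed.

Lemma eqX_sum (R : nzRingType) M (I : Type) (r : seq I) (F G : I -> {poly R}) :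
  (forall i, eqX M (F i) (G i)) -> eqX M (\sum_(i <- r) F i) (\sum_(i <- r) G i).
Proof.
move=> h; elim/big_rec2: _ => // i p q _; exact: eqXD.
Qed.

Lemma eqX_prod (R : nzRingType) M (I : eqType) (r : seq I) (F G : I -> {poly R}) :
  (forall i, i \in r -> eqX M (F i) (G i)) ->
  eqX M (\prod_(i <- r) F i) (\prod_(i <- r) G i).
Proof.
move=> h; rewrite !big_seq; elim/big_rec2: _ => // i p q /h; exact: eqXM.
Qed.

Lemma eqX_mulXn (R : nzRingType) M e (p q : {poly R}) :
  eqX (M - e) p q -> eqX M ('X^e * p) ('X^e * q).
Proof. by move=> h i lti; rewrite !coefXnM; case: ltnP => // le; apply: h; lia. Qed.

Lemma eqX_addXn (R : nzRingType) M e (p q : {poly R}) :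
  (M <= e)%N -> eqX M (p + q * 'X^e) p.
Proof. by move=> le i lti; rewrite coefD coefMXn (leq_trans lti le) addr0. Qed.

(** * Polynomials over F_2: Frobenius, and inversion modulo a power of X *)

Lemma addpp2 (p : {poly 'F_2}) : p + p = 0.
Proof. by apply: addrr_pchar2; rewrite pchar_poly; apply: pchar_Fp. Qed.

Lemma opp2 (p : {poly 'F_2}) : - p = p.
Proof. by apply/eqP; rewrite eq_sym -addr_eq0 addpp2. Qed.

Lemma sqr2D (p q : {poly 'F_2}) : (p + q) ^+ 2 = p ^+ 2 + q ^+ 2.
Proof. by rewrite sqrrD mulr2n addpp2 addr0. Qed.

(** Frobenius: cross terms cancel in characteristic 2, and the coefficients, lying in F_2, equal
    their squares. *)
Lemma sqr_comp2 (p : {poly 'F_2}) : p ^+ 2 = p \Po 'X^2.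
Proof.
elim/poly_ind: p => [|p c IH]; first by rewrite expr0n /= comp_poly0.
rewrite sqr2D exprMn IH comp_polyD comp_polyM comp_polyX comp_polyC; congr (_ + _).
by rewrite -rmorphXn /=; congr _%:P; case: c => [[|[|]]] //= i; apply/val_inj.
Qed.

Lemma coef_sqr2 (p : {poly 'F_2}) i : (p ^+ 2)`_i = if odd i then 0 else p`_(i./2).
Proof. by rewrite sqr_comp2 coef_comp_poly_Xn // dvdn2 divn2; case: odd. Qed.

Lemma expn_comp2 (p : {poly 'F_2}) s : p ^+ (2 ^ s) = p \Po 'X^(2 ^ s).
Proof.
elim: s => [|s IH]; first by rewrite comp_polyXr.
by rewrite expnS mulnC exprM IH sqr_comp2 -comp_polyA comp_Xn_poly -exprM [(2 * _)%N]mulnC.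
Qed.

(* [p ^+ (2 ^ M).-1] inverts [p] modulo ['X^M], as [p ^+ (2 ^ M)] is [p \Po 'X^(2 ^ M)]. *)
Lemma eqX_inv2 (p : {poly 'F_2}) M : p`_0 = 1 -> eqX M (p * p ^+ (2 ^ M).-1) 1.
Proof.
move=> p0; rewrite -exprS prednK ?expn_gt0 // expn_comp2 => i lti.
rewrite coef_comp_poly_Xn ?expn_gt0 // coef1.
case: i lti => [|i] lti; first by rewrite dvdn0 div0n p0.
by rewrite gtnNdvd // (leq_trans lti) // ltnW // ltn_expl.
Qed.

Lemma eqX_cancel2 (p q r : {poly 'F_2}) M :
  p`_0 = 1 -> eqX M (p * q) (p * r) -> eqX M q r.
Proof.
move=> /(@eqX_inv2 _ M) h1 h2; set p' := _ ^+ _ in h1.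
have E s : eqX M (p' * (p * s)) s.
  by rewrite mulrA (mulrC p') -[X in eqX _ _ X]mul1r; apply: eqXM.
by apply: (eqX_trans (eqX_sym (E q))); apply: eqX_trans (E r); apply: eqXM => //; apply: eqX_sym.
Qed.

(** * Gaussian binomial coefficients *)

(** The q-Pascal rule defines the coefficients without division in any commutative ring. Where the
    truncated [n' - k'] differs from the true difference, [gbinom Q n' k'] is 0. *)
Fixpoint gbinom (R : comNzRingType) (Q : R) (n k : nat) : R :=
  match n, k with
  | _, 0 => 1
  | 0, _.+1 => 0
  | n'.+1, k'.+1 => gbinom Q n' k + Q ^+ (n' - k') * gbinom Q n' k'
  end.

Lemma gbinom0 (R : comNzRingType) (Q : R) n : gbinom Q n 0 = 1.
Proof. by case: n. Qed.

Lemma gbinom_small (R : comNzRingType) (Q : R) n k : (n < k)%N -> gbinom Q n k = 0.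
Proof.
elim: n k => [|n IH] [|k] //= lt; rewrite !IH ?mulr0 ?addr0 //; lia.
Qed.

(** The q-binomial theorem in homogeneous form, so that a power of ['X] can be put for [x] and no
    negative exponents arise. In the induction, the two summands of the new factor [x + Q ^+ n] give
    the two terms of the Pascal rule. *)
Lemma gbinom_thm (R : comNzRingType) (Q x : R) n :
  \prod_(i < n) (x + Q ^+ i) =
  \sum_(k < n.+1) gbinom Q n k * Q ^+ 'C(k, 2) * x ^+ (n - k).
Proof.
elim: n => [|n IH]; first by rewrite big_ord0 big_ord1 /= !mulr1.
rewrite big_ord_recr IH /= mulrDr !mulr_suml [RHS]big_ord_recl /= bin0n !mul1r subn0.
under [X in _ = _ + X]eq_bigr => k _.
  rewrite /bump /= add1n subSS binS bin1 !mulrDl; over.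
rewrite big_split /= addrA; congr (_ + _).
  rewrite [LHS]big_ord_recl [X in _ = _ + X]big_ord_recr /= gbinom0 gbinom_small // !mul0r addr0.
  rewrite !bin0n !mul1r -exprSr !subn0; congr (_ + _); apply: eq_bigr => k _.
  rewrite /bump /= add1n binS bin1 -mulrA -exprSr; congr (_ * x ^+ _).
  by have := ltn_ord k; lia.
apply: eq_bigr => k _.
have -> : Q ^+ n = Q ^+ (n - k) * Q ^+ k.
  by rewrite -exprD; congr (_ ^+ _); have := ltn_ord k; lia.
by rewrite exprD; ring.
Qed.

Definition qpoch (R : comNzRingType) (Q : R) n := \prod_(i < n) (1 - Q ^+ i.+1).

Lemma qpochS (R : comNzRingType) (Q : R) n :
  qpoch Q n.+1 = qpoch Q n * (1 - Q ^+ n.+1).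
Proof. by rewrite /qpoch big_ord_recr. Qed.

Lemma gbinom_qpoch (R : comNzRingType) (Q : R) n k : (k <= n)%N ->
  gbinom Q n k * qpoch Q k * qpoch Q (n - k) = qpoch Q n.
Proof.
elim: n k => [|n IH] [|k] // le; rewrite ?gbinom0 ?subn0 /=.
- by rewrite /qpoch !big_ord0 !mulr1.
- by rewrite /qpoch big_ord0 !mul1r.
rewrite subSS !qpochS; have [->|ne] := eqVneq k n.
  rewrite gbinom_small // subnn expr0 add0r mul1r.
  by rewrite -[in RHS](IH n) // subnn; ring.
have IH1 := IH k.+1; rewrite qpochS in IH1.
have := IH k; have -> : (n - k = (n - k.+1).+1)%N by lia.
rewrite qpochS; set s := (n - k.+1)%N => IH0.
have E : Q ^+ n.+1 = Q ^+ s.+1 * Q ^+ k.+1 by rewrite -exprD; congr (_ ^+ _); lia.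
have {}IH0 : gbinom Q n k * qpoch Q k * (qpoch Q s * (1 - Q ^+ s.+1)) = qpoch Q n.
  by apply: IH0; lia.
have {}IH1 : gbinom Q n k.+1 * (qpoch Q k * (1 - Q ^+ k.+1)) * qpoch Q s = qpoch Q n.
  by apply: IH1; lia.
(* The two Pascal terms recombine by 1 - Q^(n+1) = (1 - Q^(s+1)) + Q^(s+1) (1 - Q^(k+1)). *)
rewrite -{1}[qpoch Q n]mulr1.
transitivity ((gbinom Q n k.+1 * (qpoch Q k * (1 - Q ^+ k.+1)) * qpoch Q s)
   * (1 - Q ^+ s.+1) + (gbinom Q n k * qpoch Q k * (qpoch Q s * (1 - Q ^+ s.+1)))
   * Q ^+ s.+1 * (1 - Q ^+ k.+1)); first by ring.
by rewrite IH0 IH1 E; ring.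
Qed.

Lemma qpoch_coef0 (R : comNzRingType) m n : (0 < m)%N -> (qpoch ('X^m : {poly R}) n)`_0 = 1.
Proof.
move=> m0; rewrite -horner_coef0 horner_prod big1 // => i _.
by rewrite hornerD hornerN -exprM hornerXn hornerC expr0n muln_eq0 /= orbF (gtn_eqF m0) subr0.
Qed.

Lemma eqX_qpoch (R : comNzRingType) m t n : (t <= n)%N ->
  eqX (m * t.+1) (qpoch ('X^m : {poly R}) n) (qpoch 'X^m t).
Proof.
elim: n => [|n IH]; first by rewrite leqn0 => /eqP->.
rewrite leq_eqVlt => /orP[/eqP->//|lt].
rewrite qpochS -[X in eqX _ _ X]mulr1; apply: eqXM; first exact: IH.
rewrite -exprM -mulN1r; apply: eqX_addXn; rewrite leq_mul2l; lia.
Qed.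

(** A finite form of the limit 1 / (Q;Q)_oo of the Gaussian binomials. With t = min(k, 2n - k), the
    products of k, 2n - k, n and 2n factors all agree with the one of t factors at this precision,
    and that one can be cancelled. *)
Lemma eqX_gbinom n m k : (0 < m)%N -> (k <= n.*2)%N ->
  eqX (m * (minn k (n.*2 - k)).+1)
    (gbinom ('X^m : {poly 'F_2}) n.*2 k * qpoch 'X^m n) 1.
Proof.
move=> m0 le; set t := minn _ _; set P := qpoch _.
have lt1 : (t <= k)%N by rewrite geq_minl.
have lt2 : (t <= n.*2 - k)%N by rewrite geq_minr.
apply: (eqX_cancel2 (p := P t)); first exact: qpoch_coef0.
have E := @eqX_qpoch 'F_2 m t.
rewrite mulr1; apply: (@eqX_trans _ _ _ (P n.*2)); last by apply: E; lia.
rewrite -[P n.*2](@gbinom_qpoch _ _ _ k) // -/P mulrCA -mulrA.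
apply: eqXM; first exact: eqX_refl.
apply: eqX_sym; apply: eqXM; first exact: E.
by apply: (eqX_trans (E _ lt2)); apply: eqX_sym; apply: E; lia.
Qed.

(** * Theta functions and the triple product *)

Definition box (n : nat) : seq int := [seq k%:Z - n%:Z | k <- iota 0 n.*2.+1].

Lemma mem_box n j : (j \in box n) = (- n%:Z <= j <= n%:Z).
Proof.
apply/mapP/idP => [[k]|le]; first by rewrite mem_iota => lt ->; lia.
by exists (absz (j + n%:Z)); rewrite ?mem_iota; lia.
Qed.

Lemma uniq_box n : uniq (box n).
Proof. by rewrite map_inj_uniq ?iota_uniq // => i j; lia. Qed.

(* [(a + b) j (j - 1) / 2 + a j], the exponents of Ramanujan's theta function f(q^a, q^b). *)
Definition theta_exp (a b : nat) (j : int) : nat :=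
  match j with
  | Posz i => (a + b) * 'C(i, 2) + a * i
  | Negz i => (a + b) * 'C(i.+1, 2) + b * i.+1
  end.

Lemma bin2_double i : ('C(i, 2) * 2)%N%:Z = i%:Z * (i%:Z - 1).
Proof.
have := mul_bin_diag i 1; rewrite bin1 => h.
case: i h => [|i] h; first by rewrite bin0n.
by rewrite mulnC -h /= -[i.+1]add1n; lia.
Qed.

Lemma theta_expE a b j :
  (theta_exp a b j)%:Z * 2 = (a + b)%N%:Z * (j * (j - 1)) + 2 * a%:Z * j.
Proof.
case: j => i; rewrite /theta_exp ?NegzE.
  by have := bin2_double i; lia.
by have := bin2_double i.+1; lia.
Qed.

(** Jacobi's triple product, without signs over F_2: a q-binomial expansion of 2n factors, shifted
    to be centred at k = n, whose coefficients become 1 once multiplied by the factors 1 + X^(m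
    i). *)
Lemma eqX_theta a b n : (0 < n)%N -> (0 < a + b)%N ->
  eqX n (\prod_(i < n) ((1 + 'X^(a + (a + b) * i)) * (1 + 'X^(b + (a + b) * i))
                         * (1 + 'X^((a + b) * i.+1))))
        (\sum_(j <- box n) ('X^(theta_exp a b j) : {poly 'F_2})).
Proof.
case: n => // n' _ m0; set n := n'.+1; set m := (a + b)%N.
set c := (b + m * n')%N; set d := (m * 'C(n, 2) + c * n)%N.
pose L : {poly 'F_2} := \prod_(i < n) ((1 + 'X^(a + m * i)) * (1 + 'X^(b + m * i))).
(* The shift [c] makes the lower n factors X^(m i) (1 + X^(b + m (n - 1 - i))) and the upper ones
   X^c (1 + X^(a + m i)); [d] collects the extracted powers. *)
have P1 : \prod_(i < n.*2) ('X^c + 'X^m ^+ i) = 'X^d * L :> {poly 'F_2}.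
  have Lo : \prod_(i < n) ('X^c + 'X^m ^+ i) =
            'X^(m * 'C(n, 2)) * \prod_(i < n) (1 + 'X^(b + m * i)) :> {poly 'F_2}.
    have -> : 'X^(m * 'C(n, 2)) = \prod_(i < n) 'X^(m * i) :> {poly 'F_2}.
      by rewrite prodrXr -bin2_sum big_distrr /= big_mkord.
    have -> : \prod_(i < n) (1 + 'X^(b + m * i)) =
              \prod_(i < n) (1 + 'X^(b + m * (n - i.+1))) :> {poly 'F_2}.
      by rewrite (reindex_inj rev_ord_inj).
    transitivity (\prod_(i < n) ('X^(m * i) * (1 + 'X^(b + m * (n - i.+1)))) : {poly 'F_2});
      last by rewrite big_split.
    apply: eq_bigr => i _ /=.
    rewrite mulrDr mulr1 -exprD -exprM addrC; congr ('X^_ + 'X^_).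
    by rewrite /c; have := ltn_ord i; rewrite /n; nia.
  have Hi : \prod_(i < n) ('X^c + 'X^m ^+ (n + i)) =
            'X^(c * n) * \prod_(i < n) (1 + 'X^(a + m * i)) :> {poly 'F_2}.
    transitivity (\prod_(i < n) ('X^c * (1 + 'X^(a + m * i))) : {poly 'F_2}); last first.
      by rewrite big_split prodr_const card_ord exprM.
    apply: eq_bigr => i _ /=.
    rewrite mulrDr mulr1 -exprD -exprM; congr ('X^_ + 'X^_).
    by rewrite /c /m /n; nia.
  by rewrite -addnn big_split_ord /= Lo Hi /L big_split /d exprD /=; ring.
have -> : \sum_(j <- box n) 'X^(theta_exp a b j) =
          \sum_(k < n.*2.+1) 'X^(theta_exp a b (k%:Z - n%:Z)) :> {poly 'F_2}.
  by rewrite big_map -[iota _ _]/(index_iota 0 n.*2.+1) big_mkord.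
have -> : \prod_(i < n) ((1 + 'X^(a + m * i)) * (1 + 'X^(b + m * i)) * (1 + 'X^(m * i.+1)))
  = L * qpoch 'X^m n :> {poly 'F_2}.
  by rewrite big_split /=; congr (_ * _); apply: eq_bigr => i _; rewrite opp2 -exprM.
have -> : L = \sum_(k < n.*2.+1) gbinom 'X^m n.*2 k * 'X^(theta_exp a b (k%:Z - n%:Z)).
  apply: (mulfI (_ : 'X^d != 0)); first by rewrite monic_neq0 ?monicXn.
  rewrite -P1 gbinom_thm mulr_sumr; apply: eq_bigr => k _.
  rewrite mulrCA -mulrA -!exprM -!exprD; congr (_ * 'X^_).
  have lek : (k <= n.*2)%N by rewrite -ltnS.
  have ca : c%:Z = m%:Z * n%:Z - a%:Z by rewrite /c /m /n; lia.
  have nn : n.*2%:Z = n%:Z + n%:Z by lia.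
  apply/eqP; rewrite -eqz_nat; apply/eqP/(mulIf (_ : 2 != 0 :> int)) => //.
  have := bin2_double k; have := bin2_double n; have := theta_expE a b (k%:Z - n%:Z).
  rewrite /d !PoszD !PoszM -subzn // nn -PoszD -/m => he hn hk.
  transitivity (m%:Z * ('C(k, 2)%:Z * 2) + 2 * c%:Z * (n%:Z + n%:Z - k%:Z)); first by ring.
  rewrite hk ca !mulrDl he -[m%:Z * _ * 2]mulrA hn; ring.
rewrite mulr_suml; apply: eqX_sum => k.
rewrite mulrAC mulrC -[X in eqX _ _ X]mulr1; apply: eqX_mulXn.
have lek : (k <= n.*2)%N by rewrite -ltnS.
apply: eqXW (eqX_gbinom m0 lek).
set j := k%:Z - n%:Z; have [hj0 hj1] : - n%:Z <= j /\ j <= n%:Z by rewrite /j; lia.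
(* The binomial is known up to degree m (n - |j| + 1), and its companion power of X has degree at
   least m (|j| - 1): every term is correct below degree m n, hence below n. *)
have h1 : (m * (absz j).-1 <= theta_exp a b j)%N.
  case: (j) => [[|i]|i]; rewrite /theta_exp -/m /= ?muln0 //.
    by rewrite binS bin1 mulnDr; lia.
  by rewrite binS bin1 mulnDr; lia.
have h2 : (minn k (n.*2 - k) = n - absz j)%N by rewrite /j; lia.
rewrite h2; nia.
Qed.

(** * Representations by sums of two squares *)

Lemma count_bij (T U : eqType) (s : seq T) (r : seq U) (P : pred T) (Q : pred U)
    (f : T -> U) (g : U -> T) :
  uniq s -> uniq r ->
  (forall x, x \in s -> P x -> [/\ f x \in r, Q (f x) & g (f x) = x]) ->
  (forall y, y \in r -> Q y -> [/\ g y \in s, P (g y) & f (g y) = y]) ->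
  count P s = count Q r.
Proof.
move=> us ur hf hg; rewrite -!size_filter -(size_map f); apply: perm_size.
apply: uniq_perm; rewrite ?filter_uniq //.
  rewrite map_inj_in_uniq ?filter_uniq // => x y; rewrite !mem_filter.
  move=> /andP[Px sx] /andP[Py sy] e; have [_ _ <-] := hf x sx Px.
  by have [_ _ <-] := hf y sy Py; rewrite e.
move=> y; rewrite mem_filter; apply/mapP/andP => [[x]|[Qy ry]].
  by rewrite mem_filter => /andP[Px sx] ->; have [] := hf x sx Px.
by have [sg Pg fg] := hg y ry Qy; exists (g y); rewrite ?mem_filter ?Pg.
Qed.

(** Parity by involution. [D] marks the points left over, which include all fixed points; off [D]
    the colour [h] is swapped by [f], so both colours are equally frequent. *)
Lemma odd_count_invol (T : eqType) (s : seq T) (P D h : pred T) (f : T -> T) :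
  uniq s ->
  (forall x, x \in s -> P x -> ~~ D x ->
    [/\ f x \in s, P (f x), ~~ D (f x), h (f x) = ~~ h x & f (f x) = x]) ->
  odd (count P s) = odd (count (fun x => P x && D x) s).
Proof.
move=> us hf; pose Q (b : bool) x := [&& P x, ~~ D x & h x == b].
have E : count (Q true) s = count (Q false) s.
  by apply: (@count_bij _ _ _ _ _ _ f f) => // x sx /and3P[Px Dx /eqP hx];
    have [sf Pf Df hfx ff] := hf x sx Px Dx; rewrite /Q sf Pf Df hfx hx ff.
have -> : count P s = (count (fun x => P x && D x) s + (count (Q true) s + count (Q false) s))%N.
  elim: s {us hf E} => //= x s ->; rewrite /Q.
  by case: (P x); case: (D x); case: (h x) => /=; lia.
by rewrite E addnn oddD odd_double addbF.
Qed.

Lemma count_pred1_uniq (T : eqType) (s : seq T) (P : pred T) x :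
  uniq s -> x \in s -> P x -> (forall y, P y -> y = x) -> count P s = 1%N.
Proof.
move=> us sx Px h; rewrite (@eq_count _ P (pred1 x)) ?count_uniq_mem ?sx //.
by move=> y /=; apply/idP/eqP => [/h|->].
Qed.

Definition box2 N : seq (int * int) := [seq (x, y) | x <- box N, y <- box N].

Lemma uniq_box2 N : uniq (box2 N).
Proof. by rewrite allpairs_uniq ?uniq_box // => -[x y] [x' y']. Qed.

Lemma mem_box2 N x y : ((x, y) \in box2 N) = (x \in box N) && (y \in box N).
Proof.
apply/allpairsP/andP => [[[x' y'] [hx hy [-> ->]]] //|[hx hy]].
by exists (x, y).
Qed.

(** An integer is at most its square in absolute value, so for [K <= N] a count over [box2 N] sees
    every representation of [K]. *)
Lemma norm_box2 (N K : nat) (x y : int) : (K <= N)%N -> x * x + y * y = K -> (x, y) \in box2 N.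
Proof. have sq (z : int) : z <= z * z /\ - z <= z * z by nia.
by move=> le h; have := sq x; have := sq y; rewrite mem_box2 !mem_box; lia.
Qed.

Definition class5 (K : nat) (a b : int) (p : int * int) : bool :=
  [&& (p.1 == a %[mod 5])%Z, (p.2 == b %[mod 5])%Z & p.1 * p.1 + p.2 * p.2 == K].

(** The condition on (u, v) for (2u + v, 2v - u), which is (u + iv)(2 - i), to be congruent to (3,
    1) modulo 5. This line of F_5^2 has the five points (4, 0), (0, 3), (1, 1), (3, 2), (2, 4). *)
Definition line5 (K : nat) (p : int * int) : bool :=
  (5 %| p.1 - 2 * p.2 + 1)%Z && (p.1 * p.1 + p.2 * p.2 == K).

Lemma odd_line5 K s :
  odd (count (line5 K) s) =
  odd (count (class5 K 4 0) s) (+) odd (count (class5 K 0 3) s)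
  (+) odd (count (class5 K 1 1) s) (+) odd (count (class5 K 3 2) s)
  (+) odd (count (class5 K 2 4) s).
Proof.
elim: s => //= -[x y] s IH; rewrite !oddD IH.
suff -> : line5 K (x, y) = class5 K 4 0 (x, y) (+) class5 K 0 3 (x, y) (+) class5 K 1 1 (x, y)
    (+) class5 K 3 2 (x, y) (+) class5 K 2 4 (x, y).
  by rewrite !oddb; do 5!case: (class5 _ _ _ _); do 5!case: (odd _).
rewrite /line5 /class5 /= {IH s}; case: eqP => _; rewrite ?andbF // !andbT.
have [h|[h|[h|[h|h]]]] : (y %% 5 = 0 \/ y %% 5 = 1 \/ y %% 5 = 2 \/ y %% 5 = 3 \/ y %% 5 = 4)%Z
  by lia.
all: rewrite !h /= ?andbF ?andbT ?addbF ?addFb; lia.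
Qed.

(* Multiplication by the Gaussian integer [2 - i]. *)
Lemma count_line5 N K : (5 * K <= N)%N ->
  count (class5 (5 * K) 3 1) (box2 N) = count (line5 K) (box2 N).
Proof.
move=> le.
apply: (@count_bij _ _ _ _ _ _
  (fun p => (((2 * p.1 - p.2) %/ 5)%Z, ((p.1 + 2 * p.2) %/ 5)%Z))
  (fun p => (2 * p.1 + p.2, 2 * p.2 - p.1))); try exact: uniq_box2.
- move=> [x y] _ /and3P[/= hx hy /eqP h].
  set u := (_ %/ _)%Z; set v := (_ %/ _)%Z.
  have [eu ev] : 5 * u = 2 * x - y /\ 5 * v = x + 2 * y by rewrite /u /v; lia.
  have ex : x = 2 * u + v by lia.
  have ey : y = 2 * v - u by lia.
  have hK : u * u + v * v = K.
    by apply: (mulfI (_ : 5 != 0)) => //; rewrite -PoszM -h ex ey; ring.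
  rewrite -ex -ey; split=> //; first by apply: (@norm_box2 N K) => //; lia.
  by rewrite /line5 /= hK eqxx andbT; lia.
- move=> [x y] _ /andP[/= h1 /eqP h].
  have h5 : (2 * x + y) * (2 * x + y) + (2 * y - x) * (2 * y - x) = (5 * K)%N.
    by rewrite PoszM -h; ring.
  split; first exact: norm_box2 h5.
    by rewrite /class5 /= h5 eqxx andbT; lia.
  by congr (_, _); lia.
Qed.

Lemma sqr_neq_double (t : nat) (x : int) : odd t -> x * x = t.*2%:Z -> False.
Proof.
move=> ot h; have [z [ez|ez]] : exists z, x = 2 * z \/ x = 2 * z + 1.
- by exists (x %/ 2)%Z; lia.
- have : 2 * (2 * (z * z)) = t.*2%:Z by rewrite -h ez; ring.
  by lia.
- have : 2 * (2 * (z * z) + 2 * z) + 1 = t.*2%:Z by rewrite -h ez; ring.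
  by lia.
Qed.

(** The reflection y -> -y preserves the class. A fixed point would have y = 0 and x^2 = 2t,
    impossible for odd t. *)
Lemma odd_class5_40 N t : (t.*2 <= N)%N -> odd t ->
  odd (count (class5 t.*2 4 0) (box2 N)) = false.
Proof.
move=> le ot; rewrite (@odd_count_invol _ _ _ pred0 (fun p => 0 < p.2) (fun p => (p.1, - p.2))).
- by rewrite (@eq_count _ _ pred0) ?count_pred0 // => p /=; rewrite andbF.
- exact: uniq_box2.
move=> [x y] _ /and3P[/= hx hy /eqP h] _.
have h' : x * x + - y * - y = t.*2 by rewrite mulrNN.
have y0 : y != 0 by apply/eqP => y0; apply: (@sqr_neq_double t x) => //; rewrite -h y0; lia.
rewrite /class5 /= h' eqxx opprK; split=> //; [exact: norm_box2 h'| by lia | by lia].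
Qed.

Lemma odd_class5_03 N t : (t.*2 <= N)%N -> odd t ->
  odd (count (class5 t.*2 0 3) (box2 N)) = false.
Proof.
move=> le ot; rewrite (@odd_count_invol _ _ _ pred0 (fun p => 0 < p.1) (fun p => (- p.1, p.2))).
- by rewrite (@eq_count _ _ pred0) ?count_pred0 // => p /=; rewrite andbF.
- exact: uniq_box2.
move=> [x y] _ /and3P[/= hx hy /eqP h] _.
have h' : - x * - x + y * y = t.*2 by rewrite mulrNN.
have x0 : x != 0 by apply/eqP => x0; apply: (@sqr_neq_double t y) => //; rewrite -h x0; lia.
rewrite /class5 /= h' eqxx opprK; split=> //; [exact: norm_box2 h'| by lia | by lia].
Qed.

Lemma odd_class5_11 N t : (t.*2 <= N)%N ->
  odd (count (class5 t.*2 1 1) (box2 N)) =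
  odd (count (fun p => class5 t.*2 1 1 p && (p.1 == p.2)) (box2 N)).
Proof.
move=> le.
apply: (@odd_count_invol _ _ _ _ (fun p => p.1 < p.2) (fun p => (p.2, p.1))).
  exact: uniq_box2.
move=> [x y] _ /and3P[/= hx hy /eqP h] xy.
have h' : y * y + x * x = t.*2 by rewrite addrC.
rewrite /class5 /= h' eqxx; split=> //; [exact: norm_box2 h'| by lia | by lia | by lia].
Qed.

(** Reflection in the antidiagonal, (x, y) -> (-y, -x), preserves the class because (-2, -3) is (3,
    2) modulo 5. *)
Lemma odd_class5_32 N t : (t.*2 <= N)%N ->
  odd (count (class5 t.*2 3 2) (box2 N)) =
  odd (count (fun p => class5 t.*2 3 2 p && (p.1 == - p.2)) (box2 N)).
Proof.
move=> le.
apply: (@odd_count_invol _ _ _ _ (fun p => 0 < p.1 + p.2) (fun p => (- p.2, - p.1))).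
  exact: uniq_box2.
move=> [x y] _ /and3P[/= hx hy /eqP h] xy.
have h' : - y * - y + - x * - x = t.*2 by rewrite !mulrNN addrC.
rewrite /class5 /= h' eqxx !opprK; split=> //; [exact: norm_box2 h'| by lia | by lia | by lia].
Qed.

Lemma count_class5_24 N K : (K <= N)%N ->
  count (class5 K 2 4) (box2 N) = count (class5 K 3 1) (box2 N).
Proof.
move=> le.
apply: (@count_bij _ _ _ _ _ _ (fun p => (- p.1, - p.2)) (fun p => (- p.1, - p.2)));
  try exact: uniq_box2.
  move=> [x y] _ /and3P[/= hx hy /eqP h].
  have h' : - x * - x + - y * - y = K by rewrite !mulrNN.
  by rewrite /class5 /= h' eqxx !opprK; split=> //; [exact: norm_box2 h'| lia].
move=> [x y] _ /and3P[/= hx hy /eqP h].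
have h' : - x * - x + - y * - y = K by rewrite !mulrNN.
by rewrite /class5 /= h' eqxx !opprK; split=> //; [exact: norm_box2 h'| lia].
Qed.

Definition is_square (n : nat) : bool := [exists s : 'I_n.+1, s * s == n]%N.

Lemma is_squareP n : reflect (exists s, n = s * s)%N (is_square n).
Proof.
apply: (iffP existsP) => [[s /eqP <-]|[s e]]; first by exists s.
have lt : (s < n.+1)%N by rewrite e; nia.
by exists (Ordinal lt); rewrite /= -e.
Qed.

(** The surviving points are (x, x) or (x, -x) with x^2 = t, so x = s or -s. One of these is 1
    modulo 5 if s is 1 or 4, one is 3 if s is 2 or 3, and neither is either residue if 5 divides
    s. *)
Lemma odd_class5_diag N t : (t.*2 <= N)%N ->
  odd (count (fun p => class5 t.*2 1 1 p && (p.1 == p.2)) (box2 N))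
  (+) odd (count (fun p => class5 t.*2 3 2 p && (p.1 == - p.2)) (box2 N))
  = is_square t && ~~ (5 %| t)%N.
Proof.
move=> le; set P := fun p => _ && _; set Q := fun p => _ && (_ == - _).
have c0 (S : pred (int * int)) : (forall p, S p -> False) -> count S (box2 N) = 0%N.
  by move=> h; rewrite (@eq_count _ S pred0) ?count_pred0 // => p /=; apply/negP => /h.
have hP p : P p -> [/\ p = (p.1, p.1), p.1 * p.1 = t & (p.1 == 1 %[mod 5])%Z].
  case: p => x y /andP[/and3P[/= hx hy /eqP h] /eqP xy]; subst y.
  by split=> //; move: h; rewrite -addnn; lia.
have hQ p : Q p -> [/\ p = (p.1, - p.1), p.1 * p.1 = t & (p.1 == 3 %[mod 5])%Z].
  case: p => x y /andP[/and3P[/= hx hy /eqP h] /eqP xy]; subst x.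
  by rewrite opprK; split=> //; move: h; rewrite mulrNN -addnn; lia.
have cP (x : int) : x * x = t -> (x == 1 %[mod 5])%Z -> P (x, x).
  by move=> h hx; rewrite /P /class5 /= h eqxx hx /=; lia.
have cQ (x : int) : x * x = t -> (x == 3 %[mod 5])%Z -> Q (x, - x).
  by move=> h hx; rewrite /Q /class5 /= mulrNN h opprK eqxx hx /=; lia.
have bx (x y : int) : x * x = t -> y * y = t -> (x, y) \in box2 N.
  by move=> hx hy; apply: (norm_box2 le); rewrite hx hy -addnn.
have [[s e]|nsq] := is_squareP; last first.
  rewrite !c0 // => p.
    by move=> /hQ[_ h _]; apply: nsq; exists (absz p.1); lia.
  by move=> /hP[_ h _]; apply: nsq; exists (absz p.1); lia.
have e' : s%:Z * s%:Z = t by rewrite e.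
have eN : - s%:Z * - s%:Z = t by rewrite mulrNN.
have sq (x : int) : x * x = t -> x = s%:Z \/ x = - s%:Z.
  rewrite -e' => /eqP; rewrite -!expr2 eqf_sqr.
  by case/orP => /eqP; [left | right].
have {}e : (t %% 5 = (s %% 5) * (s %% 5) %% 5)%N by rewrite e modnMm.
have [s0|[s1|[s2|[s3|s4]]]] : (s %% 5 = 0 \/ s %% 5 = 1 \/ s %% 5 = 2 \/ s %% 5 = 3 \/ s %% 5 = 4)%N
  by lia.
- rewrite !c0 //=; first by rewrite /dvdn e s0.
    by move=> p /hQ[_ /sq[]]; lia.
  by move=> p /hP[_ /sq[]]; lia.
- rewrite (@count_pred1_uniq _ _ P (s%:Z, s%:Z)) ?uniq_box2 ?bx ?cP //; last 2 first.
  + by lia.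
  + by move=> [x y] /hP[/= -> /sq hs hm]; congr (_, _); lia.
  rewrite c0; first by rewrite /dvdn e s1.
  by move=> p /hQ[_ /sq[]]; lia.
- rewrite (@count_pred1_uniq _ _ Q (- s%:Z, - - s%:Z)) ?uniq_box2 ?bx ?cQ ?opprK //; last 2 first.
  + by lia.
  + by move=> [x y] /hQ[/= -> /sq hs hm]; congr (_, _); lia.
  rewrite c0; first by rewrite /dvdn e s2.
  by move=> p /hP[_ /sq[]]; lia.
- rewrite (@count_pred1_uniq _ _ Q (s%:Z, - s%:Z)) ?uniq_box2 ?bx ?cQ ?opprK //; last 2 first.
  + by lia.
  + by move=> [x y] /hQ[/= -> /sq hs hm]; congr (_, _); lia.
  rewrite c0; first by rewrite /dvdn e s3.
  by move=> p /hP[_ /sq[]]; lia.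
- rewrite (@count_pred1_uniq _ _ P (- s%:Z, - s%:Z)) ?uniq_box2 ?bx ?cP //; last 2 first.
  + by lia.
  + by move=> [x y] /hP[/= -> /sq hs hm]; congr (_, _); lia.
  rewrite c0; first by rewrite /dvdn e s4.
  by move=> p /hQ[_ /sq[]]; lia.
Qed.

(** Division by 2 - i leads from norm 10t to norm 2t. Of the five classes there, two cancel, two
    leave their diagonals, and (2, 4) is the negative of (3, 1), which gives a recursion from t to t
    / 5. *)
Lemma odd_class5_31 N t : ((5 * t).*2 <= N)%N -> odd t ->
  odd (count (class5 (5 * t).*2 3 1) (box2 N)) =
  is_square t (+) ((5 %| t)%N && is_square (t %/ 5)).
Proof.
elim/ltn_ind: t => t IH le ot.
rewrite doubleMr count_line5; last by rewrite -doubleMr.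
rewrite odd_line5 odd_class5_40 ?odd_class5_03 ?odd_class5_11 ?odd_class5_32 ?addFb //;
  try by lia.
rewrite odd_class5_diag ?count_class5_24; try by lia.
(* Points of class (3, 1) have norm 9 + 1 = 0 modulo 5, so the recursive term vanishes unless 5
   divides t. *)
have [/dvdnP[u eu]|nd] := boolP (5 %| t)%N; last first.
  rewrite (@eq_count _ (class5 _ 3 1) pred0) ?count_pred0 ?andbT //.
  move=> [x y]; apply/negP => /and3P[/= hx hy /eqP h]; case/negP: nd.
  have [a ea] : exists a, x = 5 * a + 3 by exists (x %/ 5)%Z; lia.
  have [b eb] : exists b, y = 5 * b + 1 by exists (y %/ 5)%Z; lia.
  have : 5 * (5 * (a * a) + 6 * a + 5 * (b * b) + 2 * b + 2) = t.*2%:Z.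
    by rewrite -h ea eb; ring.
  by lia.
rewrite andbF addFb andTb; have -> : (t %/ 5 = u)%N by rewrite eu mulnK.
rewrite eu [(u * 5)%N]mulnC IH; try by lia.
rewrite addbC; congr (_ (+) _).
(* It remains that 5u is a square exactly when 5 divides u and u / 5 is a square. *)
apply/andP/is_squareP => [[/dvdnP[v ->]]|[s e]].
  rewrite mulnK // => /is_squareP[s ->]; exists (5 * s)%N; lia.
have : (5 %| s * s)%N by rewrite -e dvdn_mulr.
rewrite Euclid_dvdM // orbb => /dvdnP[r er].
have {}e : (u = r * r * 5)%N by move: e; rewrite er; lia.
rewrite e mulnK // dvdn_mull //; split=> //; apply/is_squareP; by exists r.
Qed.

(** * Products modulo 2 *)

Lemma natr2 n : n%:R = (odd n)%:R :> 'F_2.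
Proof.
by rewrite -{1}[n]odd_double_half natrD -mul2n natrM pchar_Fp_0 // mul0r addr0.
Qed.

Lemma prodM (R : comNzRingType) n (F G : 'I_n -> R) :
  (\prod_(i < n) F i) * (\prod_(i < n) G i) = \prod_(i < n) (F i * G i).
Proof. by rewrite big_split. Qed.

Lemma qpoch_comp (R : comNzRingType) k n :
  qpoch ('X^k : {poly R}) n = qpoch 'X n \Po 'X^k.
Proof.
rewrite /qpoch rmorph_prod; apply: eq_bigr => i _.
by rewrite rmorphB /= comp_polyC comp_Xn_poly.
Qed.

Lemma qpoch_mul (R : comNzRingType) (Q : R) m n :
  qpoch Q (m * n) = \prod_(i < n) \prod_(j < m) (1 - Q ^+ (m * i + j).+1).
Proof.
elim: n => [|n IH]; first by rewrite muln0 /qpoch !big_ord0.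
by rewrite mulnS addnC /qpoch big_split_ord big_ord_recr /= -IH.
Qed.

Lemma eqX_qpoch2 m t n : (0 < m)%N -> (t <= n)%N ->
  eqX t (qpoch ('X^m : {poly 'F_2}) n) (qpoch 'X^m t).
Proof. by move=> m0 le; apply: eqXW (eqX_qpoch _ le); nia. Qed.

(** The triple product for psi(q) = f(q, q^3) has the exponents that are 0, 1 or 3 modulo 4.
    Multiplied by A^2, whose exponents are the even numbers, it becomes A times (q^4;q^4) = A^4;
    then A^2 is cancelled. *)
Lemma eqX_qpoch_cube n : (0 < n)%N ->
  eqX n (qpoch ('X : {poly 'F_2}) n ^+ 3) (\sum_(j <- box n) 'X^(theta_exp 1 3 j)).
Proof.
move=> n0; set A := qpoch _ n; have Th := eqX_theta (a := 1) (b := 3) n0 isT.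
apply: eqX_trans Th; set L := \prod_(i < n) _.
have E : L * qpoch 'X (2 * n) ^+ 2 = qpoch 'X (4 * n) * A ^+ 4.
  have -> : A ^+ 4 = qpoch 'X^4 n by rewrite qpoch_comp -[4%N]/(2 ^ 2)%N expn_comp2.
  have -> : qpoch 'X (2 * n) ^+ 2 =
    \prod_(i < n) (1 + 'X^(2 + 4 * i)) * qpoch ('X^4 : {poly 'F_2}) n.
    rewrite sqr_comp2 -qpoch_comp qpoch_mul [qpoch _ n]/qpoch prodM /=; apply: eq_bigr => i _.
    rewrite big_ord_recl big_ord1 /= !opp2 -!exprM.
    by congr ((1 + 'X^_) * (1 + 'X^_)); rewrite /bump /=; lia.
  rewrite qpoch_mul mulrA; congr (_ * _).
  rewrite /L prodM /=; apply: eq_bigr => i _ /=.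
  rewrite !big_ord_recl big_ord0 /= !opp2 mulr1 /bump /=.
  have [-> -> -> ->] : [/\ 1 + (1 + 3) * i = (4 * i).+1, 3 + (1 + 3) * i = (4 * i).+3,
    (1 + 3) * i.+1 = (4 * i).+4 & 2 + 4 * i = (4 * i).+2]%N by split; lia.
  rewrite ?addn0 ?addn1 ?addn2 ?addn3; ring.
have A0 : (A ^+ 2)`_0 = 1 by rewrite coef_sqr2 /=; exact: (@qpoch_coef0 _ 1).
apply: eqX_sym; apply: (eqX_cancel2 A0).
apply: (@eqX_trans _ _ _ (L * qpoch 'X (2 * n) ^+ 2)).
  rewrite mulrC; apply: eqXM; first exact: eqX_refl.
  by apply: eqX_exp; apply: eqX_sym; apply: (@eqX_qpoch2 1); lia.
rewrite E -exprD exprS; apply: eqXM; last exact: eqX_refl.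
by apply: (@eqX_qpoch2 1); lia.
Qed.

Lemma coef_theta a b n i :
  (\sum_(j <- box n) ('X^(theta_exp a b j) : {poly 'F_2}))`_i =
  (count (fun j => theta_exp a b j == i) (box n))%:R.
Proof.
rewrite coef_sum -sum1_count natr_sum [RHS]big_mkcond /=; apply: eq_bigr => j _.
by rewrite coefXn eq_sym; case: eqP.
Qed.

(** Completing the square, 8 (2j^2 - j) + 1 = (4j - 1)^2, and exactly one of the two roots of an odd
    square is 3 modulo 4. *)
Lemma count_theta13 n i : (i < n)%N ->
  count (fun j => theta_exp 1 3 j == i) (box n) = is_square (8 * i + 1).
Proof.
move=> lt; have E (j : int) : (theta_exp 1 3 j == i) = ((4 * j - 1) * (4 * j - 1) == (8 * i + 1)%N).
  by have := theta_expE 1 3 j; lia.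
rewrite (eq_count E); have [[s e]|nsq] := is_squareP; last first.
  rewrite (@eq_count _ _ pred0) ?count_pred0 // => j /=; apply/negP => /eqP h; apply: nsq.
  by exists (absz (4 * j - 1)%R); lia.
have lts : (s <= 4 * i + 3)%N by nia.
have ods : odd s by have := congr1 odd e; rewrite oddD oddM /= oddM andbb => <-.
have sq (x : int) : x * x = s%:Z * s%:Z -> x = s%:Z \/ x = - s%:Z.
  move/eqP; rewrite -!expr2 eqf_sqr.
  by case/orP => /eqP; [left | right].
rewrite e.
have [s3|s1] : (s %% 4 = 3 \/ s %% 4 = 1)%N by lia.
- apply: (@count_pred1_uniq _ _ _ ((s + 1) %/ 4)%N%:Z); rewrite ?uniq_box ?mem_box //.
  + by lia.
  + by apply/eqP; rewrite PoszM; congr (_ * _); lia.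
  + by move=> y /eqP; rewrite PoszM => /sq[]; lia.
- apply: (@count_pred1_uniq _ _ _ (- ((s - 1) %/ 4)%N%:Z)); rewrite ?uniq_box ?mem_box //.
  + by lia.
  + by apply/eqP; rewrite PoszM -[RHS]mulrNN; congr (_ * _); lia.
  + by move=> y /eqP; rewrite PoszM => /sq[]; lia.
Qed.

Lemma coef_qpoch_cube n i : (i < n)%N ->
  (qpoch ('X : {poly 'F_2}) n ^+ 3)`_i = (is_square (8 * i + 1))%:R.
Proof.
move=> lt; rewrite eqX_qpoch_cube // ?(leq_ltn_trans _ lt) //.
by rewrite coef_theta count_theta13.
Qed.

Lemma coef_qpoch_exp6 n i : (i < n)%N ->
  (qpoch ('X : {poly 'F_2}) n ^+ 6)`_i = (is_square (4 * i + 1))%:R.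
Proof.
move=> lt; rewrite -[6%N]/(3 * 2)%N exprM coef_sqr2; case: ifP => oi.
  (* For odd i, 4i + 1 is 5 modulo 8, which is not a square. *)
  have -> // : is_square (4 * i + 1) = false.
  apply/negbTE/negP => /is_squareP[s e].
  have : ((4 * i + 1) %% 8 = ((s %% 8) * (s %% 8)) %% 8)%N by rewrite e modnMm.
  have : (s %% 8 < 8)%N by rewrite ltn_mod.
  by case: (s %% 8)%N => [|[|[|[|[|[|[|[|]]]]]]]] //; lia.
rewrite coef_qpoch_cube; last by lia.
by congr (is_square _)%:R; lia.
Qed.

(** The exponents in the two triple products cover the classes 4, 1, 0 and 3, 2, 0 modulo 5, so the
    multiples of 5 occur twice. *)
Lemma eqX_qpoch_mul n : (0 < n)%N ->
  eqX n (qpoch ('X : {poly 'F_2}) n * qpoch 'X^5 n)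
    ((\sum_(j <- box n) 'X^(theta_exp 4 1 j)) * (\sum_(j <- box n) 'X^(theta_exp 3 2 j))).
Proof.
move=> n0; have Th1 := eqX_theta (a := 4) (b := 1) n0 isT.
have Th2 := eqX_theta (a := 3) (b := 2) n0 isT.
apply: eqX_trans (eqXM Th1 Th2).
rewrite [X in eqX _ _ X]prodM /=.
apply: (@eqX_trans _ _ _ (qpoch 'X (5 * n) * qpoch 'X^5 n)).
  apply: eqXM; last exact: eqX_refl.
  by apply: eqX_sym; apply: (@eqX_qpoch2 1); lia.
have -> : qpoch ('X : {poly 'F_2}) (5 * n) * qpoch 'X^5 n =
  \prod_(i < n) ((1 + 'X^(4 + 5 * i)) * (1 + 'X^(1 + 5 * i)) * (1 + 'X^(5 * i.+1)) *
   ((1 + 'X^(3 + 5 * i)) * (1 + 'X^(2 + 5 * i)) * (1 + 'X^(5 * i.+1)))); last exact: eqX_refl.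
rewrite qpoch_mul prodM; apply: eq_bigr => i _.
rewrite !big_ord_recl big_ord0 /= !opp2 mulr1 /bump /= -exprM.
have [-> -> -> ->] : [/\ 4 + 5 * i = (5 * i + 3).+1, 1 + 5 * i = (5 * i).+1,
  3 + 5 * i = (5 * i).+3 & 2 + 5 * i = (5 * i).+2]%N by split; lia.
have -> : (5 * i.+1 = (5 * i + 4).+1)%N by lia.
rewrite ?addn0 ?addn1 ?addn2; ring.
Qed.

Lemma odd_sum_sqr (x y : int) : ((x * x + y * y) %% 4 = 2)%Z ->
  (x %% 2 = 1)%Z /\ (y %% 2 = 1)%Z.
Proof.
have [[a [x0|x1]] [b [y0|y1]]] : (exists a, x = 2 * a \/ x = 2 * a + 1) /\
    (exists b, y = 2 * b \/ y = 2 * b + 1).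
  by split; [exists (x %/ 2)%Z | exists (y %/ 2)%Z]; lia.
- have -> : x * x + y * y = 4 * (a * a + b * b) by rewrite x0 y0; ring.
  by lia.
- have -> : x * x + y * y = 4 * (a * a + b * b + b) + 1 by rewrite x0 y1; ring.
  by lia.
- have -> : x * x + y * y = 4 * (a * a + b * b + a) + 1 by rewrite x1 y0; ring.
  by lia.
by lia.
Qed.

(** Completing squares: 40 times the two exponents, plus 9 and 1, are (10x + 3)^2 and (10y + 1)^2,
    with sum 40i + 10. Conversely, this norm is 2 modulo 4, which forces both coordinates to be odd,
    so the class modulo 5 determines the class modulo 10. *)
Lemma count_theta41_32 n i : (i < n)%N ->
  count (fun p => theta_exp 4 1 p.1 + theta_exp 3 2 p.2 == i)%N (box2 n) =
  count (class5 (5 * (4 * i + 1)).*2 3 1) (box2 (5 * (4 * i + 1)).*2).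
Proof.
move=> lt; set K := (5 * (4 * i + 1)).*2.
have E (x y : int) : (theta_exp 4 1 x + theta_exp 3 2 y == i)%N =
    ((10 * x + 3) * (10 * x + 3) + (10 * y + 1) * (10 * y + 1) == K).
  have := theta_expE 4 1 x; have := theta_expE 3 2 y.
  have -> : (10 * x + 3) * (10 * x + 3) = 20 * (5 * (x * (x - 1)) + 8 * x) + 9 by ring.
  have -> : (10 * y + 1) * (10 * y + 1) = 20 * (5 * (y * (y - 1)) + 6 * y) + 1 by ring.
  by rewrite /K; lia.
apply: (@count_bij _ _ _ _ _ _ (fun p => (10 * p.1 + 3, 10 * p.2 + 1))
   (fun p => (((p.1 - 3) %/ 10)%Z, ((p.2 - 1) %/ 10)%Z))); try exact: uniq_box2.
  move=> [x y] _ /=; rewrite E => /eqP h; split; first exact: norm_box2 h.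
    by rewrite /class5 /= h eqxx andbT; lia.
  by congr (_, _); lia.
move=> [x y] _ /and3P[/= hx hy /eqP h].
have [|ox oy] := odd_sum_sqr (x := x) (y := y); first by rewrite h /K; lia.
set u := (_ %/ _)%Z; set v := (_ %/ _)%Z.
have eu : x = 10 * u + 3 by rewrite /u; lia.
have ev : y = 10 * v + 1 by rewrite /v; lia.
rewrite -eu -ev E -eu -ev h eqxx; split=> //.
have sq (z : int) : z <= z * z /\ - z <= z * z by nia.
have {}h : 100 * (u * u) + 60 * u + 9 + (100 * (v * v) + 20 * v + 1) = K.
  by rewrite -h eu ev; ring.
have := sq u; have := sq v; rewrite mem_box2 !mem_box; move: h; rewrite /K.
by lia.
Qed.

Lemma coef_theta_mul a b c d n i :
  ((\sum_(j <- box n) ('X^(theta_exp a b j) : {poly 'F_2})) *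
   (\sum_(j <- box n) 'X^(theta_exp c d j)))`_i =
  (count (fun p => theta_exp a b p.1 + theta_exp c d p.2 == i)%N (box2 n))%:R.
Proof.
rewrite mulr_suml; under eq_bigr do rewrite mulr_sumr.
rewrite -sum1_count natr_sum [RHS]big_mkcond big_allpairs_dep coef_sum /=.
apply: eq_bigr => x _; rewrite coef_sum; apply: eq_bigr => y _.
by rewrite -exprD coefXn eq_sym /=; case: eqP.
Qed.

Lemma coef_qpoch_mul n i : (i < n)%N ->
  (qpoch ('X : {poly 'F_2}) n * qpoch 'X^5 n)`_i =
  (is_square (4 * i + 1) (+)
   ((5 %| 4 * i + 1)%N && is_square ((4 * i + 1) %/ 5)))%:R.
Proof.
move=> lt; rewrite eqX_qpoch_mul // ?(leq_ltn_trans _ lt) //.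
by rewrite coef_theta_mul natr2 count_theta41_32 // odd_class5_31 //; lia.
Qed.

(* Modulo 2, this is Ramanujan's [psi(q)^2 - q psi(q^5)^2 = f(q, q^4) f(q^2, q^3)]. *)
Lemma eqX_key n :
  eqX n (qpoch ('X : {poly 'F_2}) n * qpoch 'X^5 n)
    (qpoch 'X n ^+ 6 + 'X * qpoch 'X^5 n ^+ 6).
Proof.
move=> i lt; rewrite coef_qpoch_mul // coefD coef_qpoch_exp6 //.
have -> : ('X * qpoch 'X^5 n ^+ 6)`_i =
  ((5 %| 4 * i + 1)%N && is_square ((4 * i + 1) %/ 5))%:R :> 'F_2.
  rewrite qpoch_comp -rmorphXn /= -['X]/('X^1) coefXnM.
  case: i lt => [|i] lt //=; rewrite subn1 /= coef_comp_poly_Xn //.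
  have -> : (5 %| 4 * i.+1 + 1)%N = (5 %| i)%N by lia.
  case: ifP => //= d5; rewrite coef_qpoch_exp6; last by lia.
  by congr (is_square _)%:R; lia.
by move: (is_square (4 * i + 1)) (_ && _) => [] []; apply/val_inj.
Qed.

(** * The eta quotient modulo 2 *)

Lemma eqX_geom (R : comNzRingType) M j : (0 < j)%N ->
  eqX M ((1 - 'X^j) * \sum_(0 <= m < M) 'X^(j * m)) (1 : {poly R}).
Proof.
move=> j0; rewrite big_mkord; under eq_bigr do rewrite exprM.
rewrite -opprB mulNr -subrX1 opprB -exprM -mulN1r; apply: eqX_addXn; nia.
Qed.

(** Clearing denominators factor by factor: each truncated geometric series times its 1 - X^j is 1
    up to degree k. *)
Lemma eqX_eta_trunc k :
  eqX k.+1 (eta_trunc k * (qpoch 'X k * qpoch 'X^10 k ^+ 5))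
    (qpoch 'X^2 k * qpoch 'X^5 k ^+ 5).
Proof.
rewrite /eta_trunc big_add1 big_mkord /= /qpoch -!prodrXl !prodM.
apply: eqX_prod => i _; rewrite -!exprM.
set F := (1 - _) * (1 - _) ^+ 5; set G := \sum_(_ <= _ < _) _; set H := \sum_(_ <= _ < _) _.
have -> : F * G * H ^+ 5 * ((1 - 'X^(i.+1)) * (1 - 'X^(10 * i.+1)) ^+ 5) =
  F * (((1 - 'X^(i.+1)) * G) * ((1 - 'X^(10 * i.+1)) * H) ^+ 5) by rewrite exprMn; ring.
rewrite -[X in eqX _ _ X]mulr1; apply: eqXM; first exact: eqX_refl.
rewrite -[X in eqX _ _ X]mulr1; apply: eqXM; first exact: eqX_geom.
by rewrite -[X in eqX _ _ X](expr1n _ 5); apply: eqX_exp; apply: eqX_geom.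
Qed.

Lemma eqX_map (R S : nzRingType) (f : {rmorphism R -> S}) M (p q : {poly R}) :
  eqX M p q -> eqX M (map_poly f p) (map_poly f q).
Proof. by move=> h i lt; rewrite !coef_map h. Qed.

Lemma map_qpoch (R S : comNzRingType) (f : {rmorphism R -> S}) m n :
  map_poly f (qpoch 'X^m n) = qpoch 'X^m n.
Proof.
rewrite /qpoch rmorph_prod; apply: eq_bigr => i _.
by rewrite rmorphB rmorph1 -!exprM /= map_polyXn.
Qed.

(** Modulo 2 the cleared identity reads T A B^10 = A^2 B^5, from which A B^5 is cancelled. *)
Lemma eqX_eta_trunc2 k :
  eqX k.+1 (map_poly intr (eta_trunc k) * qpoch ('X^5 : {poly 'F_2}) k ^+ 5) (qpoch 'X k).
Proof.
set T := map_poly _ _; set A := qpoch 'X k; set B := qpoch _ k.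
have A0 : A`_0 = 1 by apply: (@qpoch_coef0 _ 1).
have B0 : (B ^+ 5)`_0 = 1 by rewrite -horner_coef0 horner_exp horner_coef0 qpoch_coef0 ?expr1n.
apply: (eqX_cancel2 A0); apply: (eqX_cancel2 B0).
have := eqX_map (intr : {rmorphism int -> 'F_2}) (@eqX_eta_trunc k).
rewrite rmorphM [X in eqX _ (_ * X) _]rmorphM [X in eqX _ _ X]rmorphM !rmorphXn /=.
rewrite (@map_qpoch _ _ _ 1) !map_qpoch.
have -> : qpoch 'X^10 k = B ^+ 2 :> {poly 'F_2}.
  by rewrite [RHS]sqr_comp2 [LHS](@qpoch_comp 'F_2 10)
    [B](@qpoch_comp 'F_2 5) -comp_polyA comp_Xn_poly -exprM.
have -> : qpoch 'X^2 k = A ^+ 2 :> {poly 'F_2} by rewrite [RHS]sqr_comp2 [LHS](@qpoch_comp 'F_2 2).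
rewrite -/T -/A -/B.
have -> : T * (A * (B ^+ 2) ^+ 5) = B ^+ 5 * (A * (T * B ^+ 5)) by ring.
by have -> : A ^+ 2 * B ^+ 5 = B ^+ 5 * (A * A) by ring.
Qed.

Lemma coef_odd_sqr2 (p : {poly 'F_2}) n : (p ^+ 2)`_(n.*2.+1) = 0.
Proof. by rewrite coef_sqr2 /= odd_double. Qed.

Lemma coef_even_sqr2 (p : {poly 'F_2}) n : (p ^+ 2)`_(n.*2) = p`_n.
Proof. by rewrite coef_sqr2 odd_double doubleK. Qed.

(* If [A B = A^6 + X B^6] and [T B^5 = A] then [T = (A / B)^6 + X] and
   [A / B = A^6 / B^2 + X B^4], whose cube has odd part [X (A^6 + X B^6)^2]. *)
Lemma coef_4n2 M (T A B : {poly 'F_2}) n : B`_0 = 1 ->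
  eqX M (A * B) (A ^+ 6 + 'X * B ^+ 6) -> eqX M (T * B ^+ 5) A ->
  (4 * n + 2 < M)%N -> T`_(4 * n + 2) = (A * B)`_n.
Proof.
move=> /(@eqX_inv2 _ M); set I := _ ^+ _ => BI key TB lt.
(* [I] is 1 / B modulo X^M, so [C] below represents A / B. *)
have BIk k : eqX M ((B * I) ^+ k) 1 by rewrite -(expr1n _ k); apply: eqX_exp.
pose C := A * I.
have hT : eqX M T (C ^+ 6 + 'X).
  apply: (@eqX_trans _ _ _ (T * (B * I) ^+ 6)).
    by rewrite -{1}[T]mulr1; apply: eqXM (eqX_refl _) (eqX_sym (BIk 6)).
  have -> : T * (B * I) ^+ 6 = T * B ^+ 5 * (B * I ^+ 6) by ring.
  apply: (@eqX_trans _ _ _ (A * (B * I ^+ 6))); first exact: eqXM TB (eqX_refl _).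
  rewrite mulrA; apply: (@eqX_trans _ _ _ ((A ^+ 6 + 'X * B ^+ 6) * I ^+ 6)).
    exact: eqXM key (eqX_refl _).
  have -> : (A ^+ 6 + 'X * B ^+ 6) * I ^+ 6 = C ^+ 6 + 'X * (B * I) ^+ 6 by rewrite /C; ring.
  apply: eqXD (eqX_refl _) _; rewrite -[X in eqX _ _ X]mulr1.
  exact: eqXM (eqX_refl _) (BIk 6).
have hC : eqX M C (A ^+ 6 * I ^+ 2 + 'X * B ^+ 4).
  apply: (@eqX_trans _ _ _ (C * (B * I))).
    by rewrite -{1}[C]mulr1; apply: eqXM (eqX_refl _) (eqX_sym BI).
  have -> : C * (B * I) = A * B * I ^+ 2 by rewrite /C; ring.
  apply: (@eqX_trans _ _ _ ((A ^+ 6 + 'X * B ^+ 6) * I ^+ 2)).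
    exact: eqXM key (eqX_refl _).
  have -> : (A ^+ 6 + 'X * B ^+ 6) * I ^+ 2 = A ^+ 6 * I ^+ 2 + 'X * B ^+ 4 * (B * I) ^+ 2 by ring.
  apply: eqXD (eqX_refl _) _; rewrite -[X in eqX _ _ X]mulr1.
  exact: eqXM (eqX_refl _) (BIk 2).
pose W := A ^+ 6 + 'X * B ^+ 6.
have hC3 : eqX M (C ^+ 3) ((A ^+ 9 * I ^+ 3) ^+ 2 + ('X * A ^+ 3 * I * B ^+ 4) ^+ 2 + 'X * W ^+ 2).
  apply: (eqX_trans (eqX_exp 3 hC)).
  rewrite [_ ^+ 3]exprSr sqr2D.
  have -> : ((A ^+ 6 * I ^+ 2) ^+ 2 + ('X * B ^+ 4) ^+ 2) * (A ^+ 6 * I ^+ 2 + 'X * B ^+ 4) =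
    (A ^+ 9 * I ^+ 3) ^+ 2 + ('X * A ^+ 3 * I * B ^+ 4) ^+ 2 +
    'X * (A ^+ 12 * (B * I) ^+ 4 + ('X * B ^+ 6) ^+ 2) by ring.
  apply: eqXD (eqX_refl _) _; apply: eqXM (eqX_refl _) _.
  rewrite /W sqr2D -exprM; apply: eqXD _ (eqX_refl _).
  rewrite -[X in eqX _ _ X]mulr1; exact: eqXM (eqX_refl _) (BIk 4).
(* Degree 4n + 2 of the square C^6 is degree 2n + 1 of C^3. Being odd, it meets only the summand X
   W^2, in which it is degree n of W. *)
have E : (4 * n + 2 = n.*2.+1.*2)%N by lia.
rewrite hT // coefD coefX E; have -> : (n.*2.+1.*2 == 1)%N = false by lia.
rewrite addr0 (exprM C 3 2) coef_even_sqr2 hC3; last by lia.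
rewrite 2!coefD !coef_odd_sqr2 !add0r -['X]/('X^1) coefXnM /= subn1 /= coef_even_sqr2.
by rewrite key //; lia.
Qed.

Lemma dvd2_Pcoef n :
  (2 %| Pcoef (4 * n + 2))%Z =
  ~~ (is_square (4 * n + 1) (+) ((5 %| 4 * n + 1)%N && is_square ((4 * n + 1) %/ 5))).
Proof.
rewrite (dvdz_pcharf (pchar_Fp (isT : prime 2))) /Pcoef.
set k := (4 * n + 2)%N; have := @eqX_eta_trunc2 k.
set T := map_poly _ _ => h.
have -> : ((eta_trunc k)`_k)%:~R = T`_k :> 'F_2 by rewrite coef_map.
rewrite (@coef_4n2 k.+1 T (qpoch 'X k.+1) (qpoch 'X^5 k.+1) n) ?coef_qpoch_mul ?qpoch_coef0 //.
- by case: (_ (+) _).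
- by rewrite /k; lia.
- exact: eqX_key.
(* The products with k and k + 1 factors agree up to degree k. *)
apply: (@eqX_trans _ _ _ (qpoch 'X k)); last first.
  by apply: eqX_sym; apply: eqXW (@eqX_qpoch _ 1 _ _ (leqnSn k)); lia.
apply: eqX_trans h; apply: eqXM (eqX_refl _) _; apply: eqX_exp.
apply: eqXW (eqX_qpoch _ (leqnSn k)); lia.
Qed.

(** * Density *)

(** Writing the odd root as 2r + 1, 4n + 1 = (2r + 1)^2 gives the first form and 4n + 1 = 5 (2r +
    1)^2 the second. *)
Lemma odd_J10_pronic n : ~~ (2 %| J10 (4 * n + 1))%Z ->
  exists r, n = (r * r.+1)%N \/ n = (5 * (r * r.+1)).+1.
Proof.
have -> : J10 (4 * n + 1) = Pcoef (4 * n + 2).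
  by rewrite /J10 -addnS (_ : (_ == 0)%N = false) ?subr0 //; lia.
rewrite dvd2_Pcoef negbK => h.
have odd_root s : odd (s * s) -> s = (s./2 * 2 + 1)%N by rewrite oddM andbb; lia.
have [/is_squareP[s e]|nsq] := boolP (is_square (4 * n + 1)).
  exists s./2; left; have os : odd (s * s) by rewrite -e; lia.
  move: e; rewrite {1 2}(odd_root _ os); nia.
move: h; rewrite (negbTE nsq) addFb => /andP[/dvdnP[u eu]].
rewrite eu mulnK // => /is_squareP[s es].
exists s./2; right; have os : odd (s * s) by rewrite -es; lia.
by move: eu; rewrite es {1 2}(odd_root _ os); nia.
Qed.

(** In both families r^2 <= n <= t < s^2, so r < s, and each family contributes at most s values. *)
Lemma count_odd_J10 t s : (t < s * s)%N ->
  (count (fun n => ~~ (2 %| J10 (4 * n + 1))%Z) (iota 0 t.+1) <= 2 * s)%N.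
Proof.
move=> lt; set P := fun n => _.
pose L := [seq r * r.+1 | r <- iota 0 s]%N ++ [seq (5 * (r * r.+1)).+1 | r <- iota 0 s].
have -> : (2 * s = size L)%N by rewrite size_cat !size_map size_iota; lia.
rewrite -size_filter; apply: uniq_leq_size; first by rewrite filter_uniq ?iota_uniq.
move=> n; rewrite mem_filter mem_iota /= => /andP[/odd_J10_pronic[r hr] ltn].
rewrite mem_cat; apply/orP; case: hr => hr; [left | right];
  by apply/mapP; exists r; rewrite ?mem_iota //=; nia.
Qed.

Lemma count_even_bounds (R : realType) (X : R) : 1 <= X ->
  `|X - (count_even X)%:R| <= 4 * Num.sqrt X.
Proof.
move=> X1; set r := Num.sqrt X.
have X0 : 0 <= X by lra.
have rX : r * r = X by rewrite -expr2 sqr_sqrtr.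
have r1 : 1 <= r by rewrite -[1](sqrtr1 R) ler_sqrt //; lra.
have /andP[t0 t1] := truncn_itv X0.
have /andP[s0 s1] := truncn_itv (sqrtr_ge0 X).
rewrite /count_even; set t := Num.truncn X in t0 t1 *.
set P := fun n => _; set c := count P _.
(* With s = floor(sqrt X) + 1, the count lies between t + 1 - 2s and t + 1, and 2s <= 4 sqrt X
   because sqrt X >= 1. *)
have lt : (t < (Num.truncn r).+1 * (Num.truncn r).+1)%N.
  rewrite -(ltr_nat R) natrM; apply: le_lt_trans t0 _.
  by rewrite -rX; apply: ltr_pM; rewrite ?sqrtr_ge0.
have := count_odd_J10 lt.
have := count_predC P (iota 0 t.+1); rewrite size_iota -/c => hc hb.
have {}hb : (t.+1 <= c + 2 * (Num.truncn r).+1)%N by rewrite -hc leq_add2l.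
have {}hc : (c <= t.+1)%N by rewrite -hc leq_addr.
move: hb hc; rewrite -!(ler_nat R) natrD natrM -!natr1 => hb hc.
rewrite -natr1 in t1.
rewrite -/r in s0; rewrite ler_norml; apply/andP; split; lra.
Qed.

Unset Implicit Arguments.

Theorem theorem4p1 (R : realType) :
  (fun X : R => (count_even X)%:R / X) x @[x --> +oo] --> (1 : R).
Proof.
apply/cvgrPdist_le => e e0; near=> X.
have X1 : 1 <= X by near: X; apply: nbhs_pinfty_ge; rewrite num_real.
(* This threshold makes 4 <= e sqrt X, hence 4 sqrt X <= e X. *)
have Xe : (4 / e) ^+ 2 <= X by near: X; apply: nbhs_pinfty_ge; rewrite num_real.
have X0 : 0 < X by lra.
have -> : 1 - (count_even X)%:R / X = (X - (count_even X)%:R) / X.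
  by rewrite mulrBl divff // gt_eqF.
rewrite normrM normfV (gtr0_norm X0) ler_pdivrMr //.
apply: (le_trans (count_even_bounds X1)); set r := Num.sqrt X.
have er : 4 / e <= r.
  by rewrite -[4 / e]ger0_norm ?divr_ge0 ?(ltW e0) // -sqrtr_sqr ler_wsqrtr.
have {}er : 4 <= e * r by rewrite mulrC -ler_pdivrMr.
have -> : X = r * r by rewrite -expr2 sqr_sqrtr // ltW.
by rewrite mulrA; apply: ler_wpM2r; rewrite ?sqrtr_ge0.
Unshelve. all: by end_near. Qed.
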